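(* Let $H$ be a Hilbert space with orthonormal basis $\{\varphi_i\}_{i=1}^\infty$, and let $E:H\to\mathbb{R}$ be a convex function such that $\Omega:=\{x\in H: E(x)\le E(0)\}$ is bounded. Assume that $E$ satisfies Conditions 0, 1 and 2 stated in the context, with constants $M_0$, $M>0$, $\alpha>0$, $1<q\le 2$, $\beta>0$, $2\le p<\infty$. Suppose that the problem $\inf_{x\in\Omega}E(x)$ has a solution $\bar x=\sum_i c_i(\bar x)\varphi_i\in\Omega$ whose support $\bar S:=\{i: c_i(\bar x)\neq 0\}$ is finite, with cardinality $|\bar S|$. Let $\{t_k\}_{k=1}^\infty$ be a sequence with $t_k\in(0,1]$, let $(x^{\rm w}_k)_{k\ge 0}$ be any sequence generated by the algorithm WCGA(co) (defined in the context) with weakness sequence $\{t_k\}$ applied to $E$ and $\{\varphi_i\}$, and let $e^{\rm w}_k:=E(x^{\rm w}_k)-E(\bar x)$. Then at Step $k$ either $x^{\rm w}_k=\bar x$, in which case $e^{\rm w}_k=0$, or the following holds. (i) When $p\neq q$, for each $k=2,3,\ldots$, $$e^{\rm w}_k\le \tilde C\,|\bar S|^{\frac{pq}{2(p-q)}}\Bigl(\sum_{j=2}^k t_j^{\frac{q}{q-1}}\Bigr)^{-\frac{p(q-1)}{p-q}},\qquad \|x^{\rm w}_k-\bar x\|\le \tilde C'\,|\bar S|^{\frac{q}{2(p-q)}}\Bigl(\sum_{j=2}^k t_j^{\frac{q}{q-1}}\Bigr)^{-\frac{q-1}{p-q}},$$ where $\tilde C$ and $\tilde C'$ depend only on $p,q,\alpha,\beta,E$.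 (ii) When $p=q=2$, for each $k=2,3,\ldots$, $$e^{\rm w}_k\le C_2\prod_{j=2}^k\Bigl(1-\frac{\tilde C_3}{|\bar S|}t_j^2\Bigr),\qquad \|x^{\rm w}_k-\bar x\|\le C_2^{1/2}\beta_0^{-1/2}\prod_{j=2}^k\Bigl(1-\frac{\tilde C_3}{|\bar S|}t_j^2\Bigr)^{1/2},$$ where $C_2=E(0)-E(\bar x)$, $\tilde C_3$ is a constant (as in the exponential rate $1-\tilde C_3/|\bar S|\in(0,1)$, so $\tilde C_3>0$) that depends on $\alpha$, $\beta$ and $E$, and $\beta_0>0$ is the constant described in the context.
   Context: $\langle\cdot,\cdot\rangle$ and $\|\cdot\|$ are the inner product and norm of $H$; $E'(x)\in H$ denotes the Fréchet derivative (gradient) of $E$ at $x$. Condition 0: $E$ has a Fréchet derivative $E'(x)\in H$ at each $x\in\Omega$ and $\|E'(x)\|\le M_0$ for all $x\in\Omega$. Condition 1: for all $x\in\Omega$, $x'\in H$ with $\|x-x'\|\le M$: $E(x')-E(x)-\langle E'(x),x'-x\rangle\le\alpha\|x'-x\|^q$. Condition 2: for all $x\in\Omega$, $x'\in H$ with $\|x-x'\|\le M$: $E(x')-E(x)-\langle E'(x),x'-x\rangle\ge\beta\|x'-x\|^p$. Constant $\beta_0$: since $\Omega$ is convex and bounded, Condition 2 implies that there is $\beta_0>0$ with $E(x')-E(x)-\langle E'(x),x'-x\rangle\ge\beta_0\|x'-x\|^p$ for all $x,x'\in\Omega$; one may take $\beta_0=\min\{\beta,\beta L^{1-p}\}$ where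 $L>0$ is such that $\mathrm{diam}(\Omega)\le LM$. Here $\beta_0$ denotes this constant. Algorithm WCGA(co) (Weak Chebyshev Greedy Algorithm), with dictionary $\mathcal{D}=\{\pm\varphi_j\}_{j=1}^\infty$ and weakness sequence $t_k\in(0,1]$; we write $x_m$ for $x^{\rm w}_m$: Step 0: set $x_0:=0$. If $E'(x_0)=0$, stop and set $x_k:=x_0$ for $k\ge1$. Step $m$ ($m\ge1$): assuming $x_{m-1}$ has been defined and $E'(x_{m-1})\ne0$, choose $\varphi_{j_m}\in\mathcal{D}$ satisfying $|\langle E'(x_{m-1}),\varphi_{j_m}\rangle|\ge t_m\sup_{\varphi\in\mathcal{D}}\langle E'(x_{m-1}),\varphi\rangle$, and let $x_m$ be a minimizer of $E$ over $\mathrm{span}\{\varphi_{j_1},\dots,\varphi_{j_m}\}$. If $E'(x_m)=0$, stop and set $x_k:=x_m$ for $k>m$; otherwise go to Step $m+1$. The sequence generated need not be unique; the result applies to any sequence generated by the algorithm. *)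

(* Defs.v *)
From HB Require Import structures.
From mathcomp Require Import all_boot all_order all_algebra.
From mathcomp Require Import finmap.
From mathcomp Require Import all_classical all_reals all_analysis.
From mathcomp Require Import ring.

Set Implicit Arguments.
Unset Strict Implicit.
Unset Printing Implicit Defensive.
Import Order.TTheory GRing.Theory Num.Theory.
Import numFieldNormedType.Exports.

Local Open Scope classical_set_scope.
Local Open Scope ring_scope.

(* A real Hilbert space is a complete normed space H together with a positive
   definite symmetric bilinear form ip : {dot H for idfun} inducing its norm. *)
Definition induces_norm (R : realType) (H : completeNormedModType R)
    (ip : {dot H for idfun}) : Prop :=
  forall x : H, ip x x = `|x| ^+ 2.

Definition orthonormal_basis (R : realType) (H : completeNormedModType R)
    (ip : {dot H for idfun}) (phi : nat -> H) : Prop :=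
  (forall i j, ip (phi i) (phi j) = (i == j)%:R) /\
  (forall x : H, series (fun i => ip x (phi i) *: phi i) @ \oo --> x).

(* The coefficients c_i(x) in an orthonormal basis are the numbers <x, phi_i>. *)
Definition basis_support (R : realType) (H : completeNormedModType R)
    (ip : {dot H for idfun}) (phi : nat -> H) (x : H) : set nat :=
  [set i | ip x (phi i) != 0].

Definition has_gradient (R : realType) (H : completeNormedModType R)
    (ip : {dot H for idfun}) (E : H -> R) (x : H) : Prop :=
  exists g : H, is_diff x (E : H -> R^o) (ip g : H -> R^o).

(* The Riesz representative of the Fréchet derivative; only meaningful where
   [has_gradient] holds. *)
Definition gradient (R : realType) (H : completeNormedModType R)
    (ip : {dot H for idfun}) (E : H -> R) (x : H) : H :=
  get [set g | is_diff x (E : H -> R^o) (ip g : H -> R^o)].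

Definition Omega (R : realType) (H : completeNormedModType R) (E : H -> R) :
    set H :=
  [set x | E x <= E 0].

Definition minimizer_on (R : realType) (T : Type) (A : set T) (E : T -> R)
    (x : T) : Prop :=
  A x /\ forall y, A y -> E x <= E y.

Definition condition0 (R : realType) (H : completeNormedModType R)
    (ip : {dot H for idfun}) (E : H -> R) (M0 : R) : Prop :=
  forall x, Omega E x -> has_gradient ip E x /\ `|gradient ip E x| <= M0.

Definition condition1 (R : realType) (H : completeNormedModType R)
    (ip : {dot H for idfun}) (E : H -> R) (M alpha q : R) : Prop :=
  forall x x' : H, Omega E x -> `|x - x'| <= M ->
    E x' - E x - ip (gradient ip E x) (x' - x) <= alpha * `|x' - x| `^ q.

Definition condition2 (R : realType) (H : completeNormedModType R)
    (ip : {dot H for idfun}) (E : H -> R) (M beta p : R) : Prop :=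
  forall x x' : H, Omega E x -> `|x - x'| <= M ->
    beta * `|x' - x| `^ p <= E x' - E x - ip (gradient ip E x) (x' - x).

(* [is_beta0_min] below shows that min(beta, beta L^(1-p)) satisfies this when
   diam(Omega) <= L M. *)
Definition is_beta0 (R : realType) (H : completeNormedModType R)
    (ip : {dot H for idfun}) (E : H -> R) (p beta0 : R) : Prop :=
  0 < beta0 /\
  forall x x' : H, Omega E x -> Omega E x' ->
    beta0 * `|x' - x| `^ p <= E x' - E x - ip (gradient ip E x) (x' - x).

Definition dictionary (R : realType) (H : completeNormedModType R)
    (phi : nat -> H) : set H :=
  [set g | exists i, g = phi i \/ g = - phi i].

(* span {d 1, ..., d m} *)
Definition span_first (R : realType) (H : completeNormedModType R)
    (d : nat -> H) (m : nat) : set H :=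
  [set y | exists a : nat -> R, y = \sum_(1 <= i < m.+1) a i *: d i].

(* [x] is a sequence generated by the Weak Chebyshev Greedy Algorithm; d m is
   the dictionary element selected at Step m >= 1. Once the gradient vanishes
   the sequence is constant and the later d m are irrelevant. *)
Definition wcga_sequence (R : realType) (H : completeNormedModType R)
    (ip : {dot H for idfun}) (phi : nat -> H) (t : nat -> R) (E : H -> R)
    (x : nat -> H) : Prop :=
  x 0%N = 0 /\
  exists d : nat -> H, forall m : nat,
    (gradient ip E (x m) = 0 -> x m.+1 = x m) /\
    (gradient ip E (x m) <> 0 ->
      [/\ dictionary phi (d m.+1),
          t m.+1 * sup [set ip (gradient ip E (x m)) g | g in dictionary phi]
            <= `|ip (gradient ip E (x m)) (d m.+1)|
        & minimizer_on (span_first d m.+1) E (x m.+1)]).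

Lemma is_beta0_min (R : realType) (H : completeNormedModType R)
    (ip : {dot H for idfun}) (E : H -> R) (M L beta p : R) :
  convex_function (setT : set (convex_lmodType H)) E ->
  0 < M -> 0 < L -> 0 < beta -> 1 <= p ->
  condition2 ip E M beta p ->
  (forall x x', Omega E x -> Omega E x' -> `|x - x'| <= L * M) ->
  is_beta0 ip E p (Num.min beta (beta * L `^ (1 - p))).
Proof.
move=> cE M0 L0 b0 p1 c2 hL.
split; first by rewrite lt_min b0 mulr_gt0// powR_gt0.
move=> x x' Ox Ox'.
have [xx'|xx'] := leP `|x - x'| M.
  apply: le_trans (c2 _ _ Ox xx').
  by rewrite ler_wpM2r ?powR_ge0// ge_min lexx.
set D := `|x' - x|.
have DE : `|x - x'| = D by rewrite distrC.
rewrite DE in xx'; have D0 : 0 < D := lt_trans M0 xx'.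
have DLM : D <= L * M by rewrite -DE; exact: hL.
have s0 : 0 <= M / D by rewrite divr_ge0 ?ltW.
have s1 : M / D <= 1 by rewrite ler_pdivrMr// mul1r ltW.
pose y := x + (M / D) *: (x' - x).
have yx : y - x = (M / D) *: (x' - x) by rewrite /y addrC addKr.
have nyx : `|y - x| = M by rewrite yx normrZ ger0_norm// -/D divfK// gt_eqF.
have nxy : `|x - y| <= M by rewrite distrC nyx.
have := c2 x y Ox nxy; rewrite nyx yx linearZr /=.
have yE : y = (M / D) *: x' + (1 - M / D) *: x.
  by rewrite /y scalerBr scalerBl scale1r addrCA.
have Ey : E y <= (M / D) * E x' + (1 - M / D) * E x.
  by have := cE (Itv01 s0 s1) x' x (in_setT _) (in_setT _); rewrite convRE yE.
move: (ip _ _) Ey => G Ey c2y.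
have key : beta * M `^ p <= (M / D) * (E x' - E x - G).
  apply: (le_trans c2y); rewrite -subr_ge0.
  have -> : M / D * (E x' - E x - G) - (E y - E x - M / D * G) =
    M / D * E x' + (1 - M / D) * E x - E y by ring.
  by rewrite subr_ge0.
have -> : E x' - E x - G = D / M * (M / D * (E x' - E x - G)).
  by field; rewrite !gt_eqF.
apply: (@le_trans _ _ (D / M * (beta * M `^ p))); last first.
  by rewrite ler_wpM2l// divr_ge0 ?ltW.
apply: (@le_trans _ _ (beta * L `^ (1 - p) * D `^ p)).
  by rewrite ler_wpM2r ?powR_ge0// ge_min lexx orbT.
have p0 : 0 < p by rewrite (lt_le_trans _ p1).
rewrite -(mulr_powRB1 (ltW D0) p0) -(mulr_powRB1 (ltW M0) p0).
have -> : D / M * (beta * (M * M `^ (p - 1))) = beta * D * M `^ (p - 1).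
  by field; rewrite gt_eqF.
have -> : beta * L `^ (1 - p) * (D * D `^ (p - 1)) =
  beta * D * (L `^ (1 - p) * D `^ (p - 1)) by ring.
rewrite ler_wpM2l ?mulr_ge0 ?(ltW b0) ?(ltW D0)//.
rewrite -opprB powRN ler_pdivrMl ?powR_gt0// -powRM ?(ltW L0) ?(ltW M0)//.
by rewrite ge0_ler_powR ?nnegrE ?subr_ge0 ?mulr_ge0 ?(ltW L0) ?(ltW M0) ?(ltW D0).
Qed.

(* Main.v *)
Require Import Defs.
From mathcomp Require Import all_boot all_order all_algebra.
From mathcomp Require Import finmap.
From mathcomp Require Import all_classical all_reals all_analysis.
From mathcomp Require Import ring lra.
Import Order.TTheory GRing.Theory Num.Theory.
Import numFieldNormedType.Exports.
Local Open Scope classical_set_scope.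
Local Open Scope ring_scope.

(** The error e_m = E(x_m) - E(xbar) satisfies a one-step recursion
      e_(m+1) <= e_m - K |S|^(-r/2) t_(m+1)^r e_m^(1+gamma),
    with r = q/(q-1) and gamma = (p-q)/(p(q-1)), and the two rates are what this
    recursion integrates to: a power law when gamma > 0, a product of
    contraction factors when gamma = 0 (that is p = q = 2).

    The recursion comes from playing the two conditions against each other.
    The upper bound on E (smoothness) says that moving along a unit vector v by
    a well-chosen step length gains at least c |<E'(x),v>|^r ([descent_along_unit]).
    The same bound at a minimizer over a subspace forces E'(x_m) to be
    orthogonal to that subspace, since a nonzero slope would leave room for
    descent ([ip_gradient_eq0]).

    The lower bound on E (uniform convexity on the bounded set Omega) gives
    <E'(x), x - xbar> >= e + beta0 |x - xbar|^p, and by Young's inequality the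
    right-hand side is at least beta0^(1/p) e^(1-1/p) |x - xbar|
    ([pairing_ge]). The left-hand side lives on few coordinates: E'(x_m) is
    orthogonal to x_m and to the selected basis vectors, so
    <E'(x_m), x_m - xbar> is a sum over the support of xbar only, and
    Cauchy-Schwarz bounds it by |S|^(1/2) |x_m - xbar| times the largest
    coefficient of E'(x_m) ([pairing_le]). The factor |x_m - xbar| cancels, and
    the greedy choice turns the resulting lower bound on the largest coefficient
    into one on |<E'(x_m), d_(m+1)>| ([gradient_selected_ge]).

    The distance estimates follow from beta0 |x - xbar|^p <= e, which holds
    because E' vanishes at xbar. *)

Set Implicit Arguments.
Unset Strict Implicit.

(** * Recursive inequalities between real numbers *)

(** Bernoulli's inequality for an arbitrary real negative exponent, from
    1 + x <= exp x and ln (1 - u) <= - u. *)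
Lemma powR_bernoulli (R : realType) (g u : R) :
  0 <= g -> u < 1 -> 1 + g * u <= (1 - u) `^ (- g).
Proof.
move=> g0 u1; rewrite /powR gt_eqF ?subr_gt0//.
apply: le_trans (expR_ge1Dx _); rewrite lerD2l mulNr -mulrN ler_wpM2l//.
by rewrite lerNr le_ln1Dx// ltrN2.
Qed.

(** The substitution that linearizes the recursion: b <= a - D a^(1+g) is the
    discrete form of dy = - D y^(1+g) dt, along which y^(-g) grows at the
    constant rate g D. With u = D a^g the recursion reads b <= a (1 - u), and
    Bernoulli's inequality gives the discrete version with the same constant. *)
Lemma power_recursion_step (R : realType) (a b D g : R) :
  0 <= g -> 0 <= D -> 0 < b -> b <= a - D * a `^ (1 + g) ->
  a `^ (- g) + g * D <= b `^ (- g).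
Proof.
move=> g0 D0 b0 ba.
have a0 : 0 < a.
  by apply: lt_le_trans b0 (le_trans ba _); rewrite gerBl mulr_ge0 ?powR_ge0.
have gN : a `^ (- g) * a `^ g = 1 by rewrite powRN mulVf// gt_eqF// powR_gt0.
set u := D * a `^ g.
have {}ba : b <= a * (1 - u).
  apply: le_trans ba _; rewrite powRD ?(gt_eqF a0) ?implybT//.
  by rewrite powRr1 ?(ltW a0)// mulrBr mulr1 lerD2l lerN2 mulrCA.
have u1 : u < 1.
  by rewrite -subr_gt0 -(pmulr_rgt0 _ a0) (lt_le_trans b0).
apply: (@le_trans _ _ ((a * (1 - u)) `^ (- g))); last first.
  rewrite !powRN lef_pV2 ?posrE ?powR_gt0 ?mulr_gt0 ?subr_gt0//.
  by rewrite ge0_ler_powR ?nnegrE ?(ltW b0) ?mulr_ge0 ?subr_ge0 ?(ltW a0) ?(ltW u1).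
rewrite powRM ?subr_ge0 ?(ltW a0) ?(ltW u1)//.
apply: (@le_trans _ _ (a `^ (- g) * (1 + g * u))); last first.
  by rewrite ler_wpM2l ?powR_ge0 ?powR_bernoulli.
suff -> : a `^ (- g) * (1 + g * u) = a `^ (- g) + g * D by [].
have -> : g * D = g * D * (a `^ (- g) * a `^ g) by rewrite gN mulr1.
by rewrite /u; ring.
Qed.

(** The sum starts at 2 because nothing is assumed on the passage from e 0 to
    e 1. *)
Lemma power_recursion_sum (R : realType) (e w : nat -> R) (D g : R) (k : nat) :
  0 <= g -> 0 <= D -> (forall j, 0 <= w j) ->
  (forall j, (1 <= j <= k)%N -> 0 < e j) ->
  (forall j, (1 <= j < k)%N -> e j.+1 <= e j - D * w j.+1 * e j `^ (1 + g)) ->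
  (1 <= k)%N -> g * D * \sum_(2 <= j < k.+1) w j <= e k `^ (- g).
Proof.
move=> g0 D0 w0; elim: k => // -[_ _ _ _|k IH epos estep _].
  by rewrite big_geq// mulr0 powR_ge0.
rewrite big_nat_recr//= mulrDr.
have IHk : g * D * (\sum_(2 <= j < k.+2) w j) <= e k.+1 `^ (- g).
  apply: IH => // j /andP[j1 jk].
    by apply: epos; rewrite j1 ltnW.
  by apply: estep; rewrite j1 ltnW.
have step : e k.+1 `^ (- g) + g * (D * w k.+2) <= e k.+2 `^ (- g).
  apply: (power_recursion_step g0); first by rewrite mulr_ge0.
    by apply: epos; rewrite /= leqnn.
  by apply: estep; rewrite /= ltnSn.
by apply: le_trans step; rewrite lerD// mulrA.
Qed.

Lemma geometric_recursion_prod (R : realType) (e r : nat -> R) (k : nat) :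
  (forall j, (1 <= j)%N -> 0 <= r j) ->
  (forall j, (1 <= j < k)%N -> e j.+1 <= e j * r j.+1) ->
  (1 <= k)%N -> e k <= e 1%N * \prod_(2 <= j < k.+1) r j.
Proof.
move=> r0; elim: k => // -[_ _ _|k IH estep _]; first by rewrite big_geq// mulr1.
rewrite big_nat_recr//= mulrA.
apply: (le_trans (estep k.+1 _)); first by rewrite /= ltnSn.
rewrite ler_wpM2r ?r0// IH// => j /andP[j1 jk].
by apply: estep; rewrite j1 ltnW.
Qed.

Lemma le_powRN_inv (R : realType) (e X g : R) :
  0 < g -> 0 < e -> 0 < X -> X <= e `^ (- g) -> e <= X `^ (- g^-1).
Proof.
move=> g0 e0 X0 Xe.
have eE : e = (e `^ (- g)) `^ (- g^-1).
  by rewrite -powRrM mulrNN divff ?gt_eqF// powRr1 ?ltW.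
rewrite {1}eE !(powRN _ g^-1) lef_pV2 ?posrE ?powR_gt0//.
by rewrite ge0_ler_powR ?invr_ge0 ?nnegrE ?powR_ge0 ?(ltW g0) ?(ltW X0).
Qed.

Lemma prod_powR (R : realType) (f : nat -> R) (s : R) (m n : nat) :
  (forall j, (m <= j < n)%N -> 0 <= f j) ->
  \prod_(m <= j < n) f j `^ s = (\prod_(m <= j < n) f j) `^ s.
Proof.
move=> f0; rewrite big_nat [in RHS]big_nat.
suff [] : 0 <= \prod_(m <= j < n | (m <= j < n)%N) f j /\
  \prod_(m <= j < n | (m <= j < n)%N) f j `^ s =
  (\prod_(m <= j < n | (m <= j < n)%N) f j) `^ s by [].
apply: (big_rec2 (fun a b => 0 <= b /\ a = b `^ s)); first by rewrite powR1.
by move=> j a b /f0 fj0 [b0 ->]; rewrite powRM// mulr_ge0.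
Qed.

(** Young's inequality for the conjugate exponents p and (1 - 1/p)^(-1), with the
    weights 1/p and 1 - 1/p of its right-hand side bounded by 1. *)
Lemma young_power (R : realType) (a b r p : R) :
  1 < p -> 0 <= a -> 0 <= b -> 0 <= r ->
  b `^ p^-1 * a `^ (1 - p^-1) * r <= a + b * r `^ p.
Proof.
move=> p1 a0 b0 r0.
have p0 : 0 < p by lra.
have pN : p != 0 by rewrite gt_eqF.
have pi1 : p^-1 < 1 by rewrite invf_lt1.
have pi0 : 0 < 1 - p^-1 by rewrite subr_gt0.
have := @conjugate_powR R (b `^ p^-1 * r) (a `^ (1 - p^-1)) p (1 - p^-1)^-1.
rewrite mulr_ge0 ?powR_ge0// p0 invr_gt0 pi0 invrK.
rewrite subrKC => /(_ isT isT isT isT erefl).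
rewrite powRM ?powR_ge0// -!powRrM mulVf// divff ?gt_eqF// !powRr1//.
rewrite mulrAC => /le_trans; apply; rewrite addrC lerD//.
  by rewrite ler_piMr// gerBl ltW// invr_gt0.
by rewrite ler_piMr ?mulr_ge0 ?powR_ge0// ltW.
Qed.

(** The gain of an optimized step is this constant times a power of the slope;
    see [descent_stepE]. *)
Definition descent_const (R : realType) (A q : R) : R :=
  2^-1 * (2 * A) `^ (- (q - 1)^-1).

Lemma descent_const_gt0 (R : realType) (A q : R) :
  0 < A -> 0 < descent_const A q.
Proof. by move=> A0; rewrite mulr_gt0// powR_gt0// mulr_gt0. Qed.

(** The step s balances the terms so that A s^q is half of s G, which keeps
    the closed form simple; the exact minimizer of A s^q - s G would only
    improve the constant. *)
Lemma descent_stepE (R : realType) (A q G : R) : 0 < A -> 1 < q -> 0 <= G ->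
  let s := (G / (2 * A)) `^ (q - 1)^-1 in
  A * s `^ q - s * G = - (descent_const A q * G `^ (q / (q - 1))).
Proof.
move=> A0 q1 G0 s.
have q0 : 0 < q - 1 by lra.
have s0 : 0 <= s by exact: powR_ge0.
have sq : s `^ q = s * (G / (2 * A)).
  rewrite -(@mulr_powRB1 _ s q) ?s//; last lra.
  by rewrite /s -powRrM mulVf ?gt_eqF// powRr1// divr_ge0// mulr_ge0// ltW.
have -> : A * s `^ q - s * G = - (2^-1 * (s * G)).
  by rewrite sq; field; rewrite gt_eqF.
have -> : q / (q - 1) = (q - 1)^-1 + 1 by field; rewrite gt_eqF.
congr (- _); rewrite /descent_const -mulrA; congr (_ * _).
rewrite /s powRM ?invr_ge0 ?mulr_ge0 ?(ltW A0)// powRN.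
have -> : (2 * A)^-1 `^ (q - 1)^-1 = ((2 * A) `^ (q - 1)^-1)^-1.
  by rewrite -[(2 * A)^-1]powR_inv1 ?mulr_ge0 ?(ltW A0)// -powRrM mulN1r powRN.
rewrite powRD ?powRr1//; first by ring.
by rewrite gt_eqF ?addr_gt0 ?invr_gt0.
Qed.

(** * Orthonormal expansions in a Hilbert space *)

Section InnerProduct.
Context (R : realType) (H : completeNormedModType R) (ip : {dot H for idfun}).
Context (ipN : induces_norm ip).

Lemma ipC (u v : H) : ip u v = ip v u.
Proof. by rewrite hermC expr0 mul1r. Qed.

Lemma ipZl (a : R) (u v : H) : ip (a *: u) v = a * ip u v.
Proof. by rewrite linearZl_LR. Qed.

Lemma ipZr (a : R) (u v : H) : ip u (a *: v) = a * ip u v.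
Proof. by rewrite linearZr_LR. Qed.

Lemma ipBl (u v w : H) : ip (u - v) w = ip u w - ip v w.
Proof. by rewrite linearBl. Qed.

Lemma ipBr (u v w : H) : ip w (u - v) = ip w u - ip w v.
Proof. by rewrite linearBr. Qed.

Lemma ip_suml (s : seq nat) (F : nat -> H) (w : H) :
  ip (\sum_(i <- s) F i) w = \sum_(i <- s) ip (F i) w.
Proof. by rewrite linear_sumlz. Qed.

Lemma ip_sumr (s : seq nat) (F : nat -> H) (w : H) :
  ip w (\sum_(i <- s) F i) = \sum_(i <- s) ip w (F i).
Proof. by rewrite linear_sumr. Qed.

Lemma cauchy_schwarz (u v : H) : `|ip u v| <= `|u| * `|v|.
Proof.
have [->|v0] := eqVneq v 0; first by rewrite linear0r !normr0 mulr0.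
have nv : 0 < `|v| by rewrite normr_gt0.
rewrite -(@ler_pXn2r _ 2) ?nnegrE ?mulr_ge0// real_normK ?num_real// exprMn.
rewrite -subr_ge0 -(@pmulr_lge0 _ (`|v| ^+ 2)) ?exprn_gt0//.
(* The component of u orthogonal to v, scaled by |v|^2 to avoid division. *)
have := sqr_ge0 `|(`|v| ^+ 2) *: u - ip u v *: v|.
have -> : `|(`|v| ^+ 2) *: u - ip u v *: v| ^+ 2 =
    (`|u| ^+ 2 * `|v| ^+ 2 - ip u v ^+ 2) * `|v| ^+ 2.
  by rewrite -!ipN !(ipBl, ipBr, ipZl, ipZr) (ipC v u); ring.
by [].
Qed.

Section Orthonormal.
Context (phi : nat -> H) (phiB : orthonormal_basis ip phi).

Lemma basis_norm1 (i : nat) : `|phi i| = 1.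
Proof.
by apply/eqP; rewrite -(@pexpr_eq1 _ _ 2)// -ipN phiB.1 eqxx.
Qed.

Lemma ip_basis_sum (s : seq nat) (a : nat -> R) (j : nat) : uniq s ->
  ip (\sum_(i <- s) a i *: phi i) (phi j) = if j \in s then a j else 0.
Proof.
move=> us; rewrite ip_suml.
under eq_bigr do rewrite ipZl phiB.1.
case: ifP => js.
  rewrite (bigD1_seq j)//= eqxx mulr1 big1 ?addr0// => i /negbTE ->.
  by rewrite mulr0.
rewrite big_seq big1// => i si; case: eqP => [ij|_]; last by rewrite mulr0.
by rewrite -ij si in js.
Qed.

Lemma coef0_eq0 (z : H) : (forall i, ip z (phi i) = 0) -> z = 0.
Proof.
move=> z0; have := phiB.2 z.
have -> : series (fun i => ip z (phi i) *: phi i) = cst 0.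
  by apply/funext => n; rewrite /series/= big1// => i _; rewrite z0 scale0r.
move=> zlim; apply: (norm_cvg_unique zlim); exact: cvg_cst.
Qed.

(** The difference of both sides has only zero coefficients, so its expansion,
    which converges to it, is constantly zero. *)
Lemma finite_expansion (z : H) : finite_set (basis_support ip phi z) ->
  z = \sum_(i <- fset_set (basis_support ip phi z)) ip z (phi i) *: phi i.
Proof.
move=> fz; apply/eqP; rewrite -subr_eq0; apply/eqP; apply: coef0_eq0 => j.
rewrite ipBl ip_basis_sum ?fset_uniq//.
case: ifPn; first by rewrite subrr.
rewrite in_fset_set// notin_setE /basis_support/= subr0 => /negP.
by rewrite negbK => /eqP.
Qed.

(** The sum is the inner product of y with the vector of signs of the
    coefficients, whose norm is at most the square root of the size of s. *)
Lemma sum_coef_le (s : seq nat) (y : H) : uniq s ->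
  \sum_(i <- s) `|ip y (phi i)| <= Num.sqrt (size s)%:R * `|y|.
Proof.
move=> us; pose v := \sum_(i <- s) Num.sg (ip y (phi i)) *: phi i.
have vE : ip y v = \sum_(i <- s) `|ip y (phi i)|.
  by rewrite ip_sumr; apply: eq_bigr => i _; rewrite ipZr normrEsg.
rewrite -vE; apply: (le_trans (ler_norm _)); apply: (le_trans (cauchy_schwarz _ _)).
rewrite mulrC ler_wpM2r// -(@ler_pXn2r _ 2) ?nnegrE ?sqrtr_ge0//.
rewrite sqr_sqrtr// -ipN {2}/v ip_sumr -sum1_size natr_sum.
rewrite big_seq [leRHS]big_seq ler_sum// => i si.
rewrite ipZr ip_basis_sum// si -expr2.
by case: sgrP => _; rewrite ?expr0n ?sqrrN ?expr1n.
Qed.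

(** Since <g,x> = 0, the pairing is - <g,z>, a sum over the support of z. A
    term with <g,phi_i> nonzero has <x,phi_i> = 0, so the coefficient of - z
    may be replaced by that of x - z: this is what makes |x - z| appear
    instead of |z|. *)
Lemma pairing_le (g x z : H) (c : R) :
  finite_set (basis_support ip phi z) ->
  (forall i, `|ip g (phi i)| <= c) ->
  (forall i, ip g (phi i) != 0 -> ip x (phi i) = 0) ->
  ip g x = 0 ->
  ip g (x - z) <=
    Num.sqrt #|` fset_set (basis_support ip phi z)|%:R * c * `|x - z|.
Proof.
move=> fz gc gx0 gx; have c0 : 0 <= c := le_trans (normr_ge0 _) (gc 0%N).
set s := fset_set _.
have -> : ip g (x - z) = \sum_(i <- s) ip (x - z) (phi i) * ip g (phi i).
  rewrite ipBr gx sub0r {1}(finite_expansion fz) ip_sumr -/s -sumrN.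
  apply: eq_bigr => i _; rewrite ipZr ipBl mulrBl.
  have [->|/gx0 ->] := eqVneq (ip g (phi i)) 0; first by rewrite !mulr0 subrr oppr0.
  by rewrite mul0r sub0r.
rewrite mulrAC mulrC.
apply: (@le_trans _ _ (c * \sum_(i <- s) `|ip (x - z) (phi i)|)).
  rewrite mulr_sumr ler_sum// => i _.
  by rewrite (le_trans (ler_norm _))// normrM mulrC ler_wpM2r.
by rewrite ler_wpM2l// sum_coef_le// fset_uniq.
Qed.

End Orthonormal.
End InnerProduct.

(** * First-order consequences of smoothness and uniform convexity *)

Section Energy.
Context (R : realType) (H : completeNormedModType R) (ip : {dot H for idfun}).
Context (ipN : induces_norm ip) (E : H -> R).

Lemma is_beta0_exists (M beta p : R) :
  convex_function (setT : set (convex_lmodType H)) E -> bounded_set (Omega E) ->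
  0 < M -> 0 < beta -> 1 <= p -> condition2 ip E M beta p ->
  exists beta0, is_beta0 ip E p beta0.
Proof.
move=> cE bE M0 b0 p1 c2.
have [K [_ Kb]] := bE.
have {}Kb x : Omega E x -> `|x| <= `|K| + 1.
  by apply: Kb; rewrite (le_lt_trans (ler_norm _))// ltrDl.
pose L := 2 * (`|K| + 1) / M.
have K1 : 0 < `|K| + 1 by rewrite ltr_wpDl.
exists (Num.min beta (beta * L `^ (1 - p))).
apply: (is_beta0_min cE M0 _ b0 p1 c2); first by rewrite divr_gt0 ?mulr_gt0.
move=> x x' Ox Ox'; rewrite /L divfK ?gt_eqF//.
by rewrite (le_trans (ler_normB _ _))// mulr_natl mulr2n lerD// Kb.
Qed.

(** Enlarging the smoothness constant alpha to this value shortens the step of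
    [descent_stepE] enough that it stays within the range M in which the
    smoothness inequality holds, for slopes up to |M0|. *)
Definition curvature_bound (M0 M alpha q : R) : R :=
  alpha + `|M0| / (2 * M `^ (q - 1)).

Lemma curvature_bound_gt0 (M0 M alpha q : R) : 0 < M -> 0 < alpha ->
  0 < curvature_bound M0 M alpha q.
Proof.
move=> M_gt0 a0; rewrite ltr_wpDr// divr_ge0// mulr_ge0// ?powR_ge0//.
Qed.

Section Smooth.
Context (M0 M alpha q : R).
Context (M_gt0 : 0 < M) (alpha_gt0 : 0 < alpha) (q_gt1 : 1 < q).
Context (c0 : condition0 ip E M0) (c1 : condition1 ip E M alpha q).

Let A := curvature_bound M0 M alpha q.
Let A_gt0 : 0 < A. Proof. exact: curvature_bound_gt0. Qed.

(** The smoothness inequality along v, at the step length of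
    [descent_stepE] and in the direction that decreases the linear term. *)
Lemma descent_along_unit (x v : H) : Omega E x -> `|v| = 1 ->
  exists l : R, E (x + l *: v) <=
    E x - descent_const A q * `|ip (gradient ip E x) v| `^ (q / (q - 1)).
Proof.
move=> Ox v1; set g := gradient ip E x; set G := `|ip g v|.
have G0 : 0 <= G by exact: normr_ge0.
have GM0 : G <= `|M0|.
  apply: (le_trans (cauchy_schwarz ipN g v)); rewrite v1 mulr1.
  by apply: le_trans (ler_norm _); case: (c0 Ox).
pose s := (G / (2 * A)) `^ (q - 1)^-1.
have s0 : 0 <= s by exact: powR_ge0.
have q10 : 0 < q - 1 by rewrite subr_gt0.
have sM : s <= M.
  have -> : M = (M `^ (q - 1)) `^ (q - 1)^-1.
    by rewrite -powRrM divff ?gt_eqF// powRr1 ?(ltW M_gt0).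
  have A2 : 0 < 2 * A by rewrite mulr_gt0.
  rewrite ge0_ler_powR ?invr_ge0 ?(ltW q10) ?nnegrE ?powR_ge0//.
    by rewrite divr_ge0// ltW.
  rewrite ler_pdivrMr//; apply: (le_trans GM0).
  have Mq : 0 < M `^ (q - 1) by exact: powR_gt0.
  rewrite /A /curvature_bound.
  have -> : M `^ (q - 1) * (2 * (alpha + `|M0| / (2 * M `^ (q - 1)))) =
    M `^ (q - 1) * 2 * alpha + `|M0| by field; rewrite gt_eqF.
  by rewrite lerDr !mulr_ge0// ltW.
have [l lN lG] : exists2 l : R, `|l| = s & l * ip g v = - (s * G).
  rewrite /G; case: (ger0P (ip g v)) => _.
    by exists (- s); [rewrite normrN ger0_norm | ring].
  by exists s; [rewrite ger0_norm | ring].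
exists l; have dE : x + l *: v - x = l *: v by rewrite addrC addKr.
have := c1 (x' := x + l *: v) Ox.
rewrite distrC dE normrZ v1 mulr1 lN => /(_ sM); rewrite -/g ipZr lG => h.
have sq0 : 0 <= s `^ q by exact: powR_ge0.
have hA : alpha * s `^ q <= A * s `^ q.
  by rewrite ler_wpM2r// lerDl divr_ge0// mulr_ge0// powR_ge0.
have := descent_stepE A_gt0 q_gt1 G0; rewrite /= -/s => sE.
lra.
Qed.

(** A nonzero slope along v would give a strict descent. *)
Lemma ip_gradient_eq0 (x v : H) : Omega E x -> `|v| = 1 ->
  (forall l : R, E x <= E (x + l *: v)) -> ip (gradient ip E x) v = 0.
Proof.
move=> Ox v1 xmin; have [l El] := descent_along_unit Ox v1.
have /eqP := le_trans (xmin l) El.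
rewrite -subr_ge0 addrAC subrr sub0r oppr_ge0 => /eqP.
rewrite pmulr_rle0 ?descent_const_gt0// => Gle0.
apply/eqP; rewrite -normr_eq0.
have /eqP : `|ip (gradient ip E x) v| `^ (q / (q - 1)) = 0.
  by apply/eqP; rewrite eq_le Gle0 powR_ge0.
by rewrite powR_eq0 => /andP[].
Qed.

Section Minimizer.
Context (xbar : H) (xbarP : minimizer_on (Omega E) E xbar).

Lemma minimizer_le (y : H) : E xbar <= E y.
Proof.
have [Oy|/ltW E0y] := leP (E y) (E 0); first exact: xbarP.2.
by apply: le_trans E0y; exact: xbarP.1.
Qed.

(** The slope of E along the normalized gradient is the norm of the gradient. *)
Lemma gradient_minimizer : gradient ip E xbar = 0.
Proof.
apply/eqP/negPn/negP => g0; set g := gradient ip E xbar in g0.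
have gN : `|g| != 0 by rewrite normr_eq0.
have := @ip_gradient_eq0 xbar (`|g|^-1 *: g) xbarP.1.
rewrite normrZ normfV normr_id mulVf// => /(_ erefl (fun l => minimizer_le _)).
rewrite -/g ipZr ipN => /eqP; rewrite mulf_eq0 invr_eq0 sqrf_eq0 orbb.
by move/negP: gN.
Qed.

Section Growth.
Context (p beta0 : R) (p_gt0 : 0 < p) (beta0P : is_beta0 ip E p beta0).

Lemma growth_at_minimizer (x : H) : Omega E x ->
  beta0 * `|x - xbar| `^ p <= E x - E xbar.
Proof.
move=> Ox; have := beta0P.2 _ _ xbarP.1 Ox.
by rewrite gradient_minimizer linear0l subr0.
Qed.

Lemma distance_le_error (x : H) : Omega E x ->
  `|x - xbar| <= ((E x - E xbar) / beta0) `^ p^-1.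
Proof.
move=> Ox; have := growth_at_minimizer Ox; rewrite mulrC -ler_pdivlMr ?beta0P.1// => h.
have {1}-> : `|x - xbar| = (`|x - xbar| `^ p) `^ p^-1.
  by rewrite -powRrM divff ?gt_eqF// powRr1.
rewrite ge0_ler_powR ?invr_ge0 ?(ltW p_gt0) ?nnegrE ?powR_ge0//.
exact: le_trans (powR_ge0 _ _) h.
Qed.

Lemma gradient_eq0_minimizer (x : H) : Omega E x -> gradient ip E x = 0 ->
  x = xbar.
Proof.
move=> Ox gx; have := beta0P.2 _ _ Ox xbarP.1.
rewrite gx linear0l subr0 => h.
have /le_trans/(_ _) := h; move=> /(_ 0); rewrite subr_le0 minimizer_le => /(_ isT).
rewrite pmulr_rle0 ?beta0P.1// => d0.
have /eqP : `|xbar - x| `^ p = 0 by apply/eqP; rewrite eq_le d0 powR_ge0.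
by rewrite powR_eq0 => /andP[]; rewrite normr_eq0 subr_eq0 => /eqP ->.
Qed.

Lemma error_gt0 (x : H) : Omega E x -> x <> xbar -> 0 < E x - E xbar.
Proof.
move=> Ox xN; apply: lt_le_trans (growth_at_minimizer Ox).
rewrite mulr_gt0 ?beta0P.1// powR_gt0// normr_gt0 subr_eq0.
exact/eqP.
Qed.

(** Uniform convexity between x and xbar bounds the pairing below by
    e + beta0 |x - xbar|^p; Young's inequality makes this proportional to
    |x - xbar|, ready to be cancelled against [pairing_le]. *)
Lemma pairing_ge (x : H) : 1 < p -> Omega E x ->
  beta0 `^ p^-1 * (E x - E xbar) `^ (1 - p^-1) * `|x - xbar| <=
    ip (gradient ip E x) (x - xbar).
Proof.
move=> p1 Ox; have := beta0P.2 _ _ Ox xbarP.1.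
rewrite distrC => h.
have e0 : 0 <= E x - E xbar by rewrite subr_ge0 minimizer_le.
apply: (le_trans (young_power p1 e0 (ltW beta0P.1) (normr_ge0 (x - xbar)))).
by move: h; rewrite !ipBr; lra.
Qed.

End Growth.
End Minimizer.
End Smooth.
End Energy.

(** * The greedy algorithm *)

Section Span.
Context (R : realType) (H : completeNormedModType R) (d : nat -> H).

Lemma span_first_0 (m : nat) : span_first d m 0.
Proof. by exists (fun=> 0); rewrite big1// => i _; rewrite scale0r. Qed.

Lemma span_first_S (m : nat) (y : H) : span_first d m y -> span_first d m.+1 y.
Proof.
move=> [a ->]; exists (fun i => if i == m.+1 then 0 else a i).
rewrite [RHS]big_nat_recr//; cbv beta; rewrite eqxx scale0r /= addr0.
by apply: eq_big_nat => i /andP[_ im]; rewrite lt_eqF.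
Qed.

Lemma span_first_add (m j : nat) (l : R) (y : H) : (1 <= j <= m)%N ->
  span_first d m y -> span_first d m (y + l *: d j).
Proof.
move=> jm [a ->]; exists (fun i => a i + if i == j then l else 0).
under [RHS]eq_bigr do rewrite scalerDl.
rewrite big_split/=; congr (_ + _).
rewrite (bigD1_seq j) ?iota_uniq ?mem_index_iota//= eqxx big1 ?addr0// => i.
by move=> /negbTE ->; rewrite scale0r.
Qed.

Lemma ip_span_first_eq0 (ip : {dot H for idfun}) (m : nat) (y w : H) :
  (forall j, (1 <= j <= m)%N -> ip w (d j) = 0) ->
  span_first d m y -> ip w y = 0.
Proof.
move=> w0 [a ->]; rewrite ip_sumr big_nat big1// => i im.
by rewrite ipZr w0 ?mulr0.
Qed.

End Span.

(** The factor K of the error recursion: the constant of the descent lemma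
    times the power of beta0 produced by raising the lower bound of
    [gradient_selected_ge] to the power q / (q - 1). *)
Definition recursion_const (R : realType) (M0 M alpha q p beta0 : R) : R :=
  descent_const (curvature_bound M0 M alpha q) q * beta0 `^ (q / (q - 1) / p).

Section WCGA.
Context (R : realType) (H : completeNormedModType R) (ip : {dot H for idfun}).
Context (ipN : induces_norm ip) (E : H -> R).
Context (M0 M alpha q p beta0 : R).
Context (M_gt0 : 0 < M) (alpha_gt0 : 0 < alpha) (q_gt1 : 1 < q) (p_gt1 : 1 < p).
Context (c0 : condition0 ip E M0) (c1 : condition1 ip E M alpha q).
Context (beta0P : is_beta0 ip E p beta0).
Context (phi : nat -> H) (phiB : orthonormal_basis ip phi).
Context (xbar : H) (xbarP : minimizer_on (Omega E) E xbar).
Context (xbarS : finite_set (basis_support ip phi xbar)).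
Context (t : nat -> R) (t_ge0 : forall k, (1 <= k)%N -> 0 <= t k).
Context (x d : nat -> H) (x_0 : x 0%N = 0).
Context (x_step : forall m : nat,
    (gradient ip E (x m) = 0 -> x m.+1 = x m) /\
    (gradient ip E (x m) <> 0 ->
      [/\ dictionary phi (d m.+1),
          t m.+1 * sup [set ip (gradient ip E (x m)) g | g in dictionary phi]
            <= `|ip (gradient ip E (x m)) (d m.+1)|
        & minimizer_on (span_first d m.+1) E (x m.+1)])).

Notation g m := (gradient ip E (x m)).
Notation S := (#|` fset_set (basis_support ip phi xbar)|%:R : R).
Notation e m := (E (x m) - E xbar).
Notation r := (q / (q - 1)).

Lemma Omega_wcga (m : nat) : Omega E (x m).
Proof.
elim: m => [|m IH]; first by rewrite x_0 /Omega/=.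
have [/(x_step m).1 ->//|/(x_step m).2[_ _ [_ xmin]]] := pselect (g m = 0).
exact/xmin/span_first_0.
Qed.

Lemma wcga_stationary (j m : nat) : g j = 0 -> (j <= m)%N -> x m = x j.
Proof.
move=> gj /subnK <-; elim: (m - j)%N => // i IH.
by rewrite addSn (x_step _).1// IH.
Qed.

Lemma gradient_neq0_before (j m : nat) : g m <> 0 -> (j <= m)%N -> g j <> 0.
Proof. by move=> gm jm gj; apply: gm; rewrite (wcga_stationary gj jm). Qed.

(** A nonzero gradient at step m means that the algorithm has not stopped
    before, so that x m is a genuine minimizer over the selected span. *)
Lemma wcga_minimizer (m : nat) : g m <> 0 ->
  minimizer_on (span_first d m) E (x m).
Proof.
case: m => [_|m gm].
  rewrite x_0; split; first exact: span_first_0.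
  by move=> y [a ->]; rewrite big_geq.
by have [_ _] := (x_step m).2 (gradient_neq0_before gm (leqnSn m)).
Qed.

Lemma dictionary_norm1 (v : H) : dictionary phi v -> `|v| = 1.
Proof. by move=> [i [->|->]]; rewrite ?normrN (basis_norm1 ipN phiB). Qed.

Lemma wcga_dictionary (j m : nat) : g m <> 0 -> (1 <= j <= m.+1)%N ->
  dictionary phi (d j).
Proof.
case: j => // j gm /= jm.
by have [] := (x_step j).2 (gradient_neq0_before gm jm).
Qed.

Lemma gradient_orth_selected (j m : nat) : g m <> 0 -> (1 <= j <= m)%N ->
  ip (g m) (d j) = 0.
Proof.
move=> gm /andP[j1 jm].
have [xspan xmin] := wcga_minimizer gm.
apply: (ip_gradient_eq0 ipN M_gt0 alpha_gt0 q_gt1 c0 c1 (Omega_wcga m)).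
  by apply/dictionary_norm1/(wcga_dictionary gm); rewrite j1 ltnW.
by move=> l; apply: xmin; apply: span_first_add; rewrite ?j1.
Qed.

Lemma gradient_orth_iterate (m : nat) : g m <> 0 -> ip (g m) (x m) = 0.
Proof.
move=> gm; apply: (ip_span_first_eq0 _ (wcga_minimizer gm).1) => j.
exact: gradient_orth_selected.
Qed.

(** A basis vector that is not orthogonal to the gradient has not been
    selected, and x m is a combination of the selected ones. *)
Lemma unselected_coef (m i : nat) : g m <> 0 -> ip (g m) (phi i) != 0 ->
  ip (x m) (phi i) = 0.
Proof.
move=> gm gi; rewrite ipC.
apply: (ip_span_first_eq0 _ (wcga_minimizer gm).1) => j jm.
have gdj := gradient_orth_selected gm jm.
have [] := wcga_dictionary gm (j := j).
  by case/andP: jm => -> /leqW.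
move=> i' dj; have [ii|ii] := eqVneq i i'.
  move: gi; rewrite ii.
  by case: dj gdj => ->; rewrite ?linearNr/= => /eqP; rewrite ?oppr_eq0 => ->.
have pii : ip (phi i) (phi i') = 0 by rewrite phiB.1 (negbTE ii).
by case: dj => ->; rewrite ?linearNr/= pii ?oppr0.
Qed.

Lemma coef_le_sup (m i : nat) :
  `|ip (g m) (phi i)| <= sup [set ip (g m) v | v in dictionary phi].
Proof.
have ub : has_ubound [set ip (g m) v | v in dictionary phi].
  exists `|g m| => _ [v vD <-]; apply: le_trans (ler_norm _) _.
  by apply: (le_trans (cauchy_schwarz ipN _ _)); rewrite (dictionary_norm1 vD) mulr1.
rewrite ler_norml lerNl; apply/andP; split; apply: (ub_le_sup ub).
  by exists (- phi i); [exists i; right | rewrite linearNr].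
by exists (phi i) => //; exists i; left.
Qed.

(** The two bounds on <E'(x_m), x_m - xbar> share the factor |x_m - xbar|,
    which is positive and cancels; the weak greedy rule replaces the supremum
    by the selected coefficient, at the price of t_(m+1). *)
Lemma gradient_selected_ge (m : nat) : g m <> 0 -> x m <> xbar ->
  t m.+1 * (beta0 `^ p^-1 * e m `^ (1 - p^-1)) <=
    Num.sqrt S * `|ip (g m) (d m.+1)|.
Proof.
move=> gm xN; have [_ sel _] := (x_step m).2 gm.
have r_gt0 : 0 < `|x m - xbar| by rewrite normr_gt0 subr_eq0; apply/eqP.
have lower := pairing_ge xbarP beta0P p_gt1 (Omega_wcga m).
have upper := pairing_le ipN phiB xbarS (coef_le_sup m)
  (fun i => unselected_coef gm) (gradient_orth_iterate gm).
have := le_trans lower upper; rewrite ler_pM2r// => h.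
apply: (le_trans (ler_wpM2l (t_ge0 (ltn0Sn m)) h)).
by rewrite mulrCA ler_wpM2l.
Qed.

Let K := recursion_const M0 M alpha q p beta0.

(** The new iterate is at least as good as any point on the line through x m
    in the new direction, in particular as the one given by the descent lemma.
    The exponent is (1 - 1/p) q/(q-1) = 1 + (p-q)/(p(q-1)). *)
Lemma error_recursion (m : nat) : g m <> 0 -> x m <> xbar ->
  e m.+1 <= e m - K * S `^ (- (r / 2)) * t m.+1 `^ r
                  * e m `^ (1 + (p - q) / (p * (q - 1))).
Proof.
move=> gm xN; have [dm _ [_ xmin]] := (x_step m).2 gm.
have [l El] := descent_along_unit ipN M_gt0 alpha_gt0 q_gt1 c0 c1 (Omega_wcga m)
  (dictionary_norm1 dm).
have Exm : E (x m.+1) <= E (x m + l *: d m.+1).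
  apply: xmin; apply: span_first_add; first by rewrite leqnn.
  by apply: span_first_S; case: (wcga_minimizer gm).
rewrite addrAC lerD2r (le_trans Exm)// (le_trans El)// lerD2l lerN2.
have cK : 0 < descent_const (curvature_bound M0 M alpha q) q.
  by rewrite descent_const_gt0// curvature_bound_gt0.
rewrite /K /recursion_const; set c := descent_const _ _ in cK *.
rewrite -!(mulrA c) ler_wpM2l ?(ltW cK)//.
have q_sub1_gt0 : 0 < q - 1 by rewrite subr_gt0.
have r0 : 0 < r by rewrite divr_gt0//; lra.
have p0 : 0 < p := lt_trans ltr01 p_gt1.
have h := gradient_selected_ge gm xN.
have {}h : (t m.+1 * (beta0 `^ p^-1 * e m `^ (1 - p^-1))) `^ r <=
    (Num.sqrt S * `|ip (g m) (d m.+1)|) `^ r.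
  by rewrite ge0_ler_powR ?(ltW r0) ?nnegrE ?mulr_ge0 ?powR_ge0 ?sqrtr_ge0 ?t_ge0.
move: h; rewrite !powRM ?mulr_ge0 ?powR_ge0 ?sqrtr_ge0 ?t_ge0//.
rewrite -powR12_sqrt ?ler0n// -!powRrM.
have -> : p^-1 * r = r / p by rewrite mulrC.
have -> : 2^-1 * r = r / 2 by rewrite mulrC.
have -> : (1 - p^-1) * r = 1 + (p - q) / (p * (q - 1)).
  by field; rewrite !gt_eqF.
set ee := e m `^ _; set G := `|_| `^ _ => h.
(* The power of S has a negative exponent, and it is 0 when S is 0. *)
have [S0|S0] := eqVneq S 0.
  rewrite S0 powR0 ?mulr0 ?mul0r ?powR_ge0//.
  by rewrite oppr_eq0 mulf_neq0// ?invr_eq0 gt_eqF.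
have {}S0 : 0 < S by rewrite lt_neqAle eq_sym S0 ler0n.
rewrite powRN; set X := S `^ (r / 2) in h *; set B := beta0 `^ _ in h *.
have -> : B * X^-1 * t m.+1 `^ r * ee = X^-1 * (t m.+1 `^ r * (B * ee)) by ring.
by rewrite ler_pdivrMl// powR_gt0.
Qed.

(** Reaching xbar stops the algorithm, since the gradient vanishes there; so
    an iterate different from xbar certifies that every earlier step was
    performed. *)
Lemma unsolved_before (j k : nat) : x k <> xbar -> (j <= k)%N ->
  g j <> 0 /\ x j <> xbar.
Proof.
move=> xN jk.
have gk : g k <> 0.
  move=> gk; apply: xN.
  exact: (gradient_eq0_minimizer xbarP beta0P (Omega_wcga k)).
have gj := gradient_neq0_before gk jk.
split=> // xj; apply: gj; rewrite xj.
exact: (gradient_minimizer ipN M_gt0 alpha_gt0 q_gt1 c0 c1 xbarP).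
Qed.

(** If the support were empty, xbar would be 0, which is where the algorithm
    starts. *)
Lemma support_card_ge1 (k : nat) : x k <> xbar -> 1 <= S.
Proof.
move=> xN; rewrite ler1n lt0n; apply/eqP => /cardfs0_eq s0.
have [_] := unsolved_before xN (leq0n k); apply.
by rewrite x_0 (finite_expansion phiB xbarS) s0 big_seq_fset0.
Qed.

Let K_gt0 : 0 < K.
Proof.
rewrite mulr_gt0 ?powR_gt0 ?beta0P.1// descent_const_gt0//.
exact: curvature_bound_gt0.
Qed.

Lemma error_powN_ge (k : nat) : q < p -> (1 <= k)%N -> x k <> xbar ->
  (p - q) / (p * (q - 1)) * (K * S `^ (- (r / 2)))
    * (\sum_(2 <= j < k.+1) t j `^ r)
  <= e k `^ (- ((p - q) / (p * (q - 1)))).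
Proof.
move=> qp k1 xN.
apply: (@power_recursion_sum _ (fun j => e j) (fun j => t j `^ r)) => //.
- by rewrite divr_ge0 ?mulr_ge0 ?subr_ge0 ?(ltW qp) ?(ltW q_gt1)// ltW// (lt_trans ltr01).
- by rewrite mulr_ge0 ?powR_ge0 ?(ltW K_gt0).
- by move=> j; rewrite powR_ge0.
- move=> j /andP[_ jk]; have [_ xj] := unsolved_before xN jk.
  exact: (error_gt0 ipN M_gt0 alpha_gt0 q_gt1 c0 c1 xbarP beta0P (Omega_wcga j)).
- move=> j /andP[_ jk]; have [gj xj] := unsolved_before xN (ltnW jk).
  exact: error_recursion.
Qed.

(** Solving [error_powN_ge] for the error leaves this factor in front of the
    powers of S and of the sum of the t j ^ r. *)
Definition polynomial_rate_const : R :=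
  ((p - q) / (p * (q - 1)) * K) `^ (- ((p - q) / (p * (q - 1)))^-1).

Lemma error_polynomial_rate (k : nat) : (forall j, (1 <= j)%N -> 0 < t j) ->
  q < p -> (2 <= k)%N -> x k <> xbar ->
  e k <= polynomial_rate_const * S `^ (p * q / (2 * (p - q)))
           * (\sum_(2 <= j < k.+1) t j `^ r) `^ (- (p * (q - 1) / (p - q))).
Proof.
move=> t_gt0 qp k2 xN.
have p_gt0 : 0 < p := lt_trans ltr01 p_gt1.
have q10 : 0 < q - 1 by rewrite subr_gt0.
have pq0 : 0 < p - q by rewrite subr_gt0.
have S_gt0 : 0 < S := lt_le_trans ltr01 (support_card_ge1 xN).
have rate := error_powN_ge qp (ltnW k2) xN.
rewrite /polynomial_rate_const.
set gam := (p - q) / (p * (q - 1)) in rate *.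
set T := \sum_(2 <= j < k.+1) _ in rate *.
have gam0 : 0 < gam by rewrite divr_gt0// mulr_gt0.
have T0 : 0 < T.
  rewrite /T big_nat_recr//= ltr_wpDl ?sumr_ge0//.
    by move=> j _; rewrite powR_ge0.
  exact/powR_gt0/t_gt0/ltnW.
have ek0 : 0 < e k.
  exact: (error_gt0 ipN M_gt0 alpha_gt0 q_gt1 c0 c1 xbarP beta0P (Omega_wcga k)).
have X0 : 0 < gam * (K * S `^ (- (r / 2))) * T.
  by do 3![rewrite mulr_gt0//]; exact: powR_gt0.
apply: le_trans (le_powRN_inv gam0 ek0 X0 rate) _.
have D0 : 0 <= gam * K by rewrite ltW// mulr_gt0.
rewrite mulrA; move: (gam * K) D0 => D D0.
rewrite (powRM _ _ (ltW T0)) ?(powRM _ D0) ?mulr_ge0 ?powR_ge0// -powRrM.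
have -> : - (r / 2) * - gam^-1 = p * q / (2 * (p - q)).
  by rewrite /gam; field; rewrite !gt_eqF.
have -> : - gam^-1 = - (p * (q - 1) / (p - q)).
  by rewrite /gam; field; rewrite !gt_eqF.
by [].
Qed.

Lemma distance_polynomial_rate (k : nat) : (forall j, (1 <= j)%N -> 0 < t j) ->
  q < p -> (2 <= k)%N -> x k <> xbar ->
  `|x k - xbar| <=
    (polynomial_rate_const / beta0) `^ p^-1 * S `^ (q / (2 * (p - q)))
      * (\sum_(2 <= j < k.+1) t j `^ r) `^ (- ((q - 1) / (p - q))).
Proof.
move=> t_gt0 qp k2 xN.
have p_gt0 : 0 < p := lt_trans ltr01 p_gt1.
have pq0 : 0 < p - q by rewrite subr_gt0.
have C0 : 0 <= polynomial_rate_const by exact: powR_ge0.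
have b0 : 0 <= beta0^-1 by rewrite invr_ge0 ltW// beta0P.1.
have dist := distance_le_error ipN M_gt0 alpha_gt0 q_gt1 c0 c1 xbarP
  p_gt0 beta0P (Omega_wcga k).
apply: (le_trans dist).
have := error_polynomial_rate t_gt0 qp k2 xN.
set T := \sum_(2 <= j < k.+1) _ => rate.
have -> : q / (2 * (p - q)) = p * q / (2 * (p - q)) * p^-1.
  by field; rewrite !gt_eqF.
have -> : - ((q - 1) / (p - q)) = - (p * (q - 1) / (p - q)) * p^-1.
  by field; rewrite !gt_eqF.
rewrite (powRrM S) (powRrM T) -!powRM ?mulr_ge0 ?powR_ge0//.
rewrite ge0_ler_powR ?invr_ge0 ?(ltW p_gt0) ?nnegrE ?mulr_ge0 ?powR_ge0//.
  by rewrite subr_ge0 (minimizer_le xbarP).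
by rewrite (mulrAC _ beta0^-1) (mulrAC _ beta0^-1) ler_wpM2r.
Qed.

Lemma contraction_factor_ge0 (C : R) (k : nat) :
  (forall j, (1 <= j)%N -> t j <= 1) -> 0 <= C -> C <= 1 -> x k <> xbar ->
  forall j, (1 <= j)%N -> 0 <= 1 - C / S * t j ^+ 2.
Proof.
move=> t_le1 C_ge0 C_le1 xN j j1.
have S_ge1 := support_card_ge1 xN; have S_gt0 : 0 < S := lt_le_trans ltr01 S_ge1.
rewrite subr_ge0 mulr_ile1 ?divr_ge0 ?sqr_ge0 ?(ltW S_gt0)//.
  by rewrite ler_pdivrMr// mul1r (le_trans C_le1).
by rewrite expr_le1 ?t_ge0 ?t_le1.
Qed.

(** For p = q = 2 the recursion is linear in the error. The constant C may be
    any nonnegative lower bound of K; the bound C <= 1 keeps the factors nonnegative, so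
    that they can be multiplied. *)
Lemma error_geometric_rate (C : R) (k : nat) : p = 2 -> q = 2 ->
  (forall j, (1 <= j)%N -> t j <= 1) ->
  0 <= C -> C <= K -> C <= 1 -> (1 <= k)%N -> x k <> xbar ->
  e k <= (E 0 - E xbar) * \prod_(2 <= j < k.+1) (1 - C / S * t j ^+ 2).
Proof.
move=> p2 q2 t_le1 C_ge0 CK C_le1 k1 xN.
have S_ge1 := support_card_ge1 xN; have S_gt0 : 0 < S := lt_le_trans ltr01 S_ge1.
have factor_ge0 := contraction_factor_ge0 t_le1 C_ge0 C_le1 xN.
have rE : r = 2 by rewrite q2; field.
have step j : (1 <= j < k)%N ->
    e j.+1 <= e j * (1 - C / S * t j.+1 ^+ 2).
  move=> /andP[_ jk]; have [gj xj] := unsolved_before xN (ltnW jk).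
  have ej0 : 0 <= e j by rewrite subr_ge0 (minimizer_le xbarP).
  apply: (le_trans (error_recursion gj xj)).
  rewrite rE p2 q2 subrr mul0r addr0 powRr1// divff// powR_inv1 ?(ltW S_gt0)//.
  rewrite (@powR_mulrn _ _ 2) ?t_ge0// [leRHS]mulrBr mulr1 lerD2l lerN2 mulrC.
  by do 3![rewrite ler_wpM2r ?sqr_ge0 ?invr_ge0 ?(ltW S_gt0)//].
apply: le_trans (geometric_recursion_prod (e := fun j => e j) factor_ge0 step k1) _.
rewrite ler_wpM2r ?lerD2r ?(Omega_wcga 1)// big_nat prodr_ge0// => j /andP[j2 _].
exact/factor_ge0/ltnW.
Qed.

Lemma distance_geometric_rate (C b : R) (k : nat) : p = 2 -> q = 2 ->
  (forall j, (1 <= j)%N -> t j <= 1) ->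
  0 <= C -> C <= K -> C <= 1 -> (1 <= k)%N -> x k <> xbar ->
  is_beta0 ip E p b ->
  `|x k - xbar| <= (E 0 - E xbar) `^ 2^-1 * b `^ (- 2^-1)
    * \prod_(2 <= j < k.+1) (1 - C / S * t j ^+ 2) `^ 2^-1.
Proof.
move=> p2 q2 t_le1 C_ge0 CK C_le1 k1 xN bP.
have p_gt0 : 0 < p := lt_trans ltr01 p_gt1.
have factor_ge0 := contraction_factor_ge0 t_le1 C_ge0 C_le1 xN.
have rate := error_geometric_rate p2 q2 t_le1 C_ge0 CK C_le1 k1 xN.
have b_ge0 : 0 <= b^-1 by rewrite invr_ge0 ltW// bP.1.
rewrite prod_powR; last by move=> j /andP[j2 _]; apply/factor_ge0/ltnW.
have P_ge0 : 0 <= \prod_(2 <= j < k.+1) (1 - C / S * t j ^+ 2).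
  by rewrite big_nat prodr_ge0// => j /andP[j2 _]; apply/factor_ge0/ltnW.
have e0_ge0 : 0 <= E 0 - E xbar by rewrite subr_ge0 (minimizer_le xbarP).
apply: (le_trans (distance_le_error ipN M_gt0 alpha_gt0 q_gt1 c0 c1 xbarP
  p_gt0 bP (Omega_wcga k))).
have -> : b `^ (- 2^-1) = b^-1 `^ 2^-1.
  by rewrite -[b^-1]powR_inv1 ?(ltW bP.1)// -powRrM mulN1r.
rewrite mulrAC p2 -!powRM ?mulr_ge0//.
rewrite ge0_ler_powR ?invr_ge0 ?nnegrE ?mulr_ge0//.
  by rewrite subr_ge0 (minimizer_le xbarP).
by rewrite ler_wpM2r.
Qed.

End WCGA.

(** * The convergence rates *)

Unset Implicit Arguments.

Theorem theorem4p6 (R : realType) (H : completeNormedModType R)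
    (ip : {dot H for idfun}) (E : H -> R) (q p alpha beta : R) :
  induces_norm ip ->
  convex_function (setT : set (convex_lmodType H)) E ->
  bounded_set (Omega E) ->
  1 < q <= 2 -> 2 <= p -> 0 < alpha -> 0 < beta ->
  exists C C' C3 : R, [/\ 0 < C, 0 < C', 0 < C3 &
  forall (phi : nat -> H) (M0 M : R) (xbar : H) (t : nat -> R) (x : nat -> H),
    orthonormal_basis ip phi ->
    0 < M ->
    condition0 ip E M0 ->
    condition1 ip E M alpha q ->
    condition2 ip E M beta p ->
    minimizer_on (Omega E) E xbar ->
    finite_set (basis_support ip phi xbar) ->
    (forall k, (1 <= k)%N -> 0 < t k <= 1) ->
    wcga_sequence ip phi t E x ->
    let S : R := #|` fset_set (basis_support ip phi xbar)|%:R in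
    let e (k : nat) : R := E (x k) - E xbar in
    let C2 : R := E 0 - E xbar in
    forall k, (2 <= k)%N ->
      (x k = xbar /\ e k = 0) \/
      ((p <> q ->
          let T : R := \sum_(2 <= j < k.+1) t j `^ (q / (q - 1)) in
          e k <= C * S `^ (p * q / (2 * (p - q)))
                   * T `^ (- (p * (q - 1) / (p - q))) /\
          `|x k - xbar| <= C' * S `^ (q / (2 * (p - q)))
                              * T `^ (- ((q - 1) / (p - q)))) /\
       (p = 2 -> q = 2 ->
          [/\ 0 < 1 - C3 / S < 1,
              e k <= C2 * \prod_(2 <= j < k.+1) (1 - C3 / S * t j ^+ 2) &
              forall beta0 : R, is_beta0 ip E p beta0 ->
                `|x k - xbar| <=
                  C2 `^ 2^-1 * beta0 `^ (- 2^-1)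
                  * \prod_(2 <= j < k.+1) (1 - C3 / S * t j ^+ 2) `^ 2^-1]))].
Proof.
move=> ipN Econv Ebnd /andP[q_gt1 q_le2] p_ge2 alpha_gt0 beta_gt0.
have p_gt1 : 1 < p by rewrite (lt_le_trans _ p_ge2)// ltr1n.
(* The constants have to be found before M0 and M are given. Whether some
   admissible pair exists is a property of E, and one pair fixed in advance
   serves all the others: the sequence and its gradients do not depend on it. *)
have [smooth|not_smooth] := pselect (exists M0 M : R, [/\ 0 < M,
  condition0 ip E M0, condition1 ip E M alpha q & condition2 ip E M beta p]);
  last first.
  exists 1, 1, 1; split=> // phi M0 M xbar t x _ M_gt0 c0 c1 c2.
  by exfalso; apply: not_smooth; exists M0, M.
case: smooth => M0 [M [M_gt0 c0 c1 c2]].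
have [beta0 beta0P] :=
  is_beta0_exists Econv Ebnd M_gt0 beta_gt0 (ltW p_gt1) c2.
have A_gt0 := curvature_bound_gt0 M0 q M_gt0 alpha_gt0.
pose K := recursion_const M0 M alpha q p beta0.
have K_gt0 : 0 < K by rewrite mulr_gt0 ?powR_gt0 ?beta0P.1// descent_const_gt0.
pose C := polynomial_rate_const M0 M alpha q p beta0.
have C_gt0 : 0 < C.
  (* For p = q the base is 0, but the exponent is - 0^-1 = 0. *)
  rewrite /C /polynomial_rate_const; have [->|pq] := eqVneq p q.
    by rewrite subrr !mul0r invr0 oppr0 powRr0.
  have qp : q < p by rewrite lt_neqAle eq_sym pq (le_trans q_le2).
  rewrite powR_gt0// mulr_gt0// divr_gt0 ?mulr_gt0 ?subr_gt0//.
  exact: lt_trans p_gt1.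
(* The cap 1/2 ensures 0 < 1 - C3/S < 1, because S >= 1. *)
pose C3 := Num.min K 2^-1.
have C3_gt0 : 0 < C3 by rewrite lt_min; apply/andP; split=> //; rewrite invr_gt0.
exists C, ((C / beta0) `^ p^-1), C3; split=> //.
  by rewrite powR_gt0// divr_gt0// beta0P.1.
move=> phi _ _ xbar t x phiB _ _ _ _ xbarP xbarS t01 [x_0 [d x_step]] S e C2 k k2.
have [xk|xN] := pselect (x k = xbar).
  by left; split=> //; rewrite /e xk subrr.
right.
have t_gt0 j : (1 <= j)%N -> 0 < t j by move=> /t01 /andP[].
have t_le1 j : (1 <= j)%N -> t j <= 1 by move=> /t01 /andP[].
have t_ge0 j : (1 <= j)%N -> 0 <= t j by move=> /t_gt0 /ltW.
split=> [pq T|p2 q2].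
  have qp : q < p.
    by rewrite lt_neqAle (le_trans q_le2 p_ge2) andbT eq_sym; apply/eqP.
  split.
    exact: (error_polynomial_rate ipN M_gt0 alpha_gt0 q_gt1 p_gt1 c0 c1 beta0P
      phiB xbarP xbarS t_ge0 x_0 x_step).
  exact: (distance_polynomial_rate ipN M_gt0 alpha_gt0 q_gt1 p_gt1 c0 c1 beta0P
    phiB xbarP xbarS t_ge0 x_0 x_step).
have S_ge1 : 1 <= S.
  exact: (support_card_ge1 ipN M_gt0 alpha_gt0 q_gt1 c0 c1 beta0P
    phiB xbarP xbarS x_0 x_step xN).
have C3_le : C3 <= 2^-1 by rewrite ge_min lexx orbT.
have C3_lt1 : C3 < 1 by apply: le_lt_trans C3_le _; rewrite invf_lt1 ?ltr1n.
have C3_leK : C3 <= K by rewrite ge_min lexx.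
split.
- have S_gt0 : 0 < S := lt_le_trans ltr01 S_ge1.
  rewrite subr_gt0 ltrBlDr ltrDl divr_gt0// andbT ltr_pdivrMr// mul1r.
  exact: lt_le_trans S_ge1.
- exact: (error_geometric_rate ipN M_gt0 alpha_gt0 q_gt1 p_gt1 c0 c1 beta0P
    phiB xbarP xbarS t_ge0 x_0 x_step p2 q2 t_le1 (ltW C3_gt0) C3_leK
    (ltW C3_lt1) (ltnW k2) xN).
- move=> b bP.
  exact: (distance_geometric_rate ipN M_gt0 alpha_gt0 q_gt1 p_gt1 c0 c1 beta0P
    phiB xbarP xbarS t_ge0 x_0 x_step p2 q2 t_le1 (ltW C3_gt0) C3_leK
    (ltW C3_lt1) (ltnW k2) xN bP).
Qed.
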